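(* Let $k$ be an algebraically closed field of characteristic $0$ and $R=k\langle x,y\rangle/(xy-yx-y^2)$. A complete set of pairwise non-isomorphic finite dimensional irreducible $R$-modules is $\{S_a \mid a\in k\}$, where $S_a$ is the one-dimensional vector space $ku$ with the action $xu=au$, $yu=0$. All finite dimensional completely reducible representations of $R$ are given (up to isomorphism) by the matrices $Y_n=0$ and $X_n=\mathrm{diag}(a_1,\dots,a_n)$ with $a_1,\dots,a_n\in k$, where $X_n$, $Y_n$ are the images of $x$, $y$. *)

(* Defs.v *)
From HB Require Import structures.
From mathcomp Require Import all_boot all_order all_algebra.
From mathcomp Require Import finmap monalg boolp.

Set Implicit Arguments.
Unset Strict Implicit.
Unset Printing Implicit Defensive.

Import GRing.Theory.
Local Open Scope ring_scope.
Local Open Scope quotient_scope.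

(* The two-sided ideal generated by r, as a boolean predicate (classically) so
   that MathComp's quotients apply. *)
Definition two_sided_ideal (A : nzRingType) (r : A) : {pred A} :=
  fun p => `[< exists s : seq (A * A), p = \sum_(t <- s) t.1 * r * t.2 >].
Arguments two_sided_ideal : clear implicits.

Section TwoSidedIdeal.
Variables (A : nzRingType) (r : A).
Local Notation I := (two_sided_ideal A r).

Lemma two_sided_idealP (p : A) :
  reflect (exists s : seq (A * A), p = \sum_(t <- s) t.1 * r * t.2) (p \in I).
Proof. exact: asboolP. Qed.

Lemma two_sided_ideal_zmod : zmod_closed I.
Proof.
split; first by apply/two_sided_idealP; exists [::]; rewrite big_nil.
move=> _ _ /two_sided_idealP [s ->] /two_sided_idealP [t ->].
apply/two_sided_idealP; exists (s ++ [seq (- u.1, u.2) | u <- t]).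
rewrite big_cat big_map /=; congr (_ + _); rewrite -sumrN.
by apply: eq_bigr => u _; rewrite !mulNr.
Qed.

HB.instance Definition _ := GRing.isZmodClosed.Build A I two_sided_ideal_zmod.

Lemma two_sided_idealMl (a p : A) : p \in I -> a * p \in I.
Proof.
move=> /two_sided_idealP [s ->]; apply/two_sided_idealP.
exists [seq (a * u.1, u.2) | u <- s]; rewrite big_map mulr_sumr.
by apply: eq_bigr => u _; rewrite !mulrA.
Qed.

Lemma two_sided_idealMr (a p : A) : p \in I -> p * a \in I.
Proof.
move=> /two_sided_idealP [s ->]; apply/two_sided_idealP.
exists [seq (u.1, u.2 * a) | u <- s]; rewrite big_map mulr_suml.
by apply: eq_bigr => u _; rewrite !mulrA.
Qed.

Lemma two_sided_ideal_gen : r \in I.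
Proof.
by apply/two_sided_idealP; exists [:: (1, 1)]; rewrite big_seq1 mul1r mulr1.
Qed.

Lemma two_sided_ideal_ker (S : nzRingType) (e : {rmorphism A -> S}) (p : A) :
  e r = 0 -> p \in I -> e p = 0.
Proof.
move=> er0 /two_sided_idealP [s ->]; rewrite rmorph_sum big1 // => t _.
by rewrite !rmorphM er0 mulr0 mul0r.
Qed.

End TwoSidedIdeal.

(* A/(r), for an algebra A in which the ideal (r) is proper. *)
Definition quotient_algebra (k : fieldType) (A : algType k) (r : A)
    (r_proper : 1 \notin two_sided_ideal A r) : Type :=
  {ideal_quot (two_sided_ideal A r : zmodClosed A)}.

Section QuotientAlgebra.
Variables (k : fieldType) (A : algType k) (r : A).
Hypothesis r_proper : 1 \notin two_sided_ideal A r.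
Local Notation I := (two_sided_ideal A r).
Local Notation Q := (quotient_algebra r_proper).

HB.instance Definition _ := GRing.Zmodule.on Q.
HB.instance Definition _ := ZmodQuotient.on Q.

Definition quo (p : A) : Q := \pi_Q p.
Definition quo_repr (u : Q) : A := repr u.

Lemma quoP (p q : A) : reflect (quo p = quo q) (p - q \in I).
Proof. by rewrite Quotient.idealrBE; apply: eqP. Qed.

Lemma quo_reprK u : quo (quo_repr u) = u.
Proof. exact: reprK. Qed.

Lemma quoD p q : quo (p + q) = quo p + quo q.
Proof. exact: raddfD. Qed.

Lemma quoB p q : quo (p - q) = quo p - quo q.
Proof. exact: raddfB. Qed.

Lemma quo0 : quo 0 = 0.
Proof. exact: raddf0. Qed.

Lemma quo_reprB p : p - quo_repr (quo p) \in I.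
Proof. by apply/quoP; rewrite quo_reprK. Qed.

Definition quo_mul (u v : Q) : Q := quo (quo_repr u * quo_repr v).
Definition quo_scale (c : k) (u : Q) : Q := quo (c *: quo_repr u).

Lemma quo_mulE p q : quo (p * q) = quo_mul (quo p) (quo q).
Proof.
apply/quoP; have Ip := quo_reprB p; have Iq := quo_reprB q.
move: Ip Iq; set p' := quo_repr _; set q' := quo_repr _ => Ip Iq.
have -> : p * q - p' * q' = (p - p') * q + p' * (q - q').
  by rewrite mulrBl mulrBr addrA subrK.
by apply: rpredD; [apply: two_sided_idealMr | apply: two_sided_idealMl].
Qed.

Lemma quo_scaleE c p : quo (c *: p) = quo_scale c (quo p).
Proof.
apply/quoP; rewrite -scalerBr -mulr_algl.
by apply: two_sided_idealMl; apply: quo_reprB.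
Qed.

Fact quo_mulA : associative quo_mul.
Proof.
move=> u v w; rewrite -[u]quo_reprK -[v]quo_reprK -[w]quo_reprK.
by rewrite -!quo_mulE mulrA.
Qed.

Fact quo_mul1r : left_id (quo 1) quo_mul.
Proof. by move=> u; rewrite -[u]quo_reprK -quo_mulE mul1r. Qed.

Fact quo_mulr1 : right_id (quo 1) quo_mul.
Proof. by move=> u; rewrite -[u]quo_reprK -quo_mulE mulr1. Qed.

Fact quo_mulDl : left_distributive quo_mul +%R.
Proof.
move=> u v w; rewrite -[u]quo_reprK -[v]quo_reprK -[w]quo_reprK.
by rewrite -quoD -!quo_mulE -quoD mulrDl.
Qed.

Fact quo_mulDr : right_distributive quo_mul +%R.
Proof.
move=> u v w; rewrite -[u]quo_reprK -[v]quo_reprK -[w]quo_reprK.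
by rewrite -quoD -!quo_mulE -quoD mulrDr.
Qed.

Fact quo_one_neq0 : quo 1 != 0.
Proof.
by apply: contraNneq r_proper; rewrite -quo0 => /quoP; rewrite subr0.
Qed.

HB.instance Definition _ := GRing.Zmodule_isNzRing.Build Q
  quo_mulA quo_mul1r quo_mulr1 quo_mulDl quo_mulDr quo_one_neq0.

Fact quo_scaleA c d u : quo_scale c (quo_scale d u) = quo_scale (c * d) u.
Proof. by rewrite -[u]quo_reprK -!quo_scaleE scalerA. Qed.

Fact quo_scale1 : left_id 1 quo_scale.
Proof. by move=> u; rewrite -[u]quo_reprK -quo_scaleE scale1r. Qed.

Fact quo_scaleDr : right_distributive quo_scale +%R.
Proof.
move=> c u v; rewrite -[u]quo_reprK -[v]quo_reprK.
by rewrite -quoD -!quo_scaleE -quoD scalerDr.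
Qed.

Fact quo_scaleDl u : {morph quo_scale^~ u : c d / c + d}.
Proof.
by move=> c d; rewrite -[u]quo_reprK -!quo_scaleE -quoD scalerDl.
Qed.

HB.instance Definition _ := GRing.Zmodule_isLmodule.Build k Q
  quo_scaleA quo_scale1 quo_scaleDr quo_scaleDl.

Lemma quoM p q : quo (p * q) = quo p * quo q.
Proof. exact: quo_mulE. Qed.

Lemma quoZ c p : quo (c *: p) = c *: quo p.
Proof. exact: quo_scaleE. Qed.

Fact quo_scaleAl (c : k) (u v : Q) : c *: (u * v) = (c *: u) * v.
Proof.
by rewrite -[u]quo_reprK -[v]quo_reprK -quoM -!quoZ -quoM scalerAl.
Qed.

HB.instance Definition _ := GRing.Lmodule_isLalgebra.Build k Q quo_scaleAl.

Fact quo_scaleAr (c : k) (u v : Q) : c *: (u * v) = u * (c *: v).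
Proof.
by rewrite -[u]quo_reprK -[v]quo_reprK -quoM -!quoZ -quoM scalerAr.
Qed.

HB.instance Definition _ := GRing.Lalgebra_isAlgebra.Build k Q quo_scaleAr.

Fact quo_is_zmod_morphism : zmod_morphism quo.
Proof. exact: quoB. Qed.
Fact quo_is_monoid_morphism : monoid_morphism quo.
Proof. by split=> // p q; apply: quoM. Qed.
Fact quo_is_scalable : scalable quo.
Proof. by move=> c p; apply: quoZ. Qed.

HB.instance Definition _ :=
  GRing.isZmodMorphism.Build A Q quo quo_is_zmod_morphism.
HB.instance Definition _ :=
  GRing.isMonoidMorphism.Build A Q quo quo_is_monoid_morphism.
HB.instance Definition _ :=
  GRing.isScalable.Build k A Q *:%R quo quo_is_scalable.

Lemma quo_gen : quo r = 0.
Proof.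
by rewrite -quo0; apply/quoP; rewrite subr0; apply: two_sided_ideal_gen.
Qed.

End QuotientAlgebra.

Fact malg_scaleAr (k : fieldType) (K : monomType) (c : k) (p q : {malg k[K]}) :
  c *: (p * q) = p * (c *: q).
Proof.
apply/malgP => w; rewrite mcoeffZ.
rewrite (@mcoeffMlw _ _ (msupp p) (msupp q) p q) //.
rewrite (@mcoeffMlw _ _ (msupp p) (msupp q) p (c *: q)) ?msuppZ_le //.
rewrite mulr_sumr; apply: eq_bigr => u _; rewrite mulr_sumr.
by apply: eq_bigr => v _; rewrite mcoeffZ mulrnAr mulrCA.
Qed.

(* The free algebra k<x,y>: the monoid algebra of the free monoid on the two
   letters false (for x) and true (for y).  It is an alias because multinomials
   declares {malg k[K]} an algType for commutative K only. *)
Definition free_algebra (k : fieldType) : Type := {malg k[{fmonom bool}]}.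
HB.instance Definition _ (k : fieldType) :=
  GRing.Lalgebra.on (free_algebra k).
HB.instance Definition _ (k : fieldType) :=
  GRing.Lalgebra_isAlgebra.Build k (free_algebra k)
    (@malg_scaleAr k {fmonom bool}).

Definition free_x (k : fieldType) : free_algebra k := << fmu false >>.
Definition free_y (k : fieldType) : free_algebra k := << fmu true >>.

Definition jordan_rel (A : nzRingType) (x y : A) : A :=
  x * y - y * x - y ^+ 2.

Lemma jordan_rel_ker (A : nzRingType) (S : comNzRingType)
    (e : {rmorphism A -> S}) (x y : A) : e y = 0 -> e (jordan_rel x y) = 0.
Proof.
move=> ey; rewrite /jordan_rel !rmorphB expr2 !rmorphM /= ey.
by rewrite !(mulr0, mul0r, subr0).
Qed.

Lemma jordan_proper (k : fieldType) :
  1 \notin two_sided_ideal (free_algebra k) (jordan_rel (free_x k) (free_y k)).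
Proof.
apply/negP => I1; suff /eqP : (@mcoeff {fmonom bool} k mone) 1 = 0.
  by rewrite rmorph1 oner_eq0.
apply: two_sided_ideal_ker I1; apply: jordan_rel_ker.
rewrite /= mcoeffU; suff -> : (fmu true == mone) = false by [].
by apply/eqP => /(congr1 (@fmonom_val _)); rewrite fm1 fmuE.
Qed.

(* R = k<x,y>/(xy - yx - y^2) *)
Definition jordan_plane (k : fieldType) : algType k :=
  GRing.Algebra.clone k (quotient_algebra (jordan_proper k)) _.
Definition jordan_x (k : fieldType) : jordan_plane k := quo _ (free_x k).
Definition jordan_y (k : fieldType) : jordan_plane k := quo _ (free_y k).

Lemma jordan_relation (k : fieldType) :
  jordan_rel (jordan_x k) (jordan_y k) = 0.
Proof.
rewrite /jordan_rel /jordan_x /jordan_y -!rmorphM -rmorphXn -!rmorphB.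
exact: quo_gen.
Qed.

Section Modules.
Variable R : nzRingType.

Definition isomorphic (M N : lmodType R) : Prop :=
  exists f : {linear M -> N}, bijective f.

Definition irreducible_submodule (M : lmodType R) (N : {pred M}) : Prop :=
  [/\ submod_closed N,
      exists2 m, m \in N & m != 0
    & forall L : {pred M}, submod_closed L -> {subset L <= N} ->
        (exists2 m, m \in L & m != 0) -> {subset N <= L}].

Definition irreducible (M : lmodType R) : Prop :=
  @irreducible_submodule M predT.

(* M is the internal direct sum of the submodules N i. *)
Definition direct_sum (M : lmodType R) n (N : 'I_n -> {pred M}) : Prop :=
  (forall i, submod_closed (N i)) /\
  (forall m : M, exists! c : {ffun 'I_n -> M},
     (forall i, c i \in N i) /\ m = \sum_i c i).

(* Only finite direct sums are considered (the empty one included); for finite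
   dimensional modules every direct sum of irreducibles is finite. *)
Definition completely_reducible (M : lmodType R) : Prop :=
  exists n (N : 'I_n -> {pred M}),
    (forall i, irreducible_submodule (N i)) /\ direct_sum N.

End Modules.

(* A module over a k-algebra R, seen as a k-vector space through k -> R. *)
Definition restrict_scalars (k : fieldType) (R : algType k) (M : lmodType R)
  : Type := M.

Section RestrictScalars.
Variables (k : fieldType) (R : algType k) (M : lmodType R).
Local Notation V := (restrict_scalars M).

HB.instance Definition _ := GRing.Zmodule.on V.

Definition rs_scale (c : k) (v : V) : V := (c%:A : R) *: (v : M).

Fact rs_scaleA c d v : rs_scale c (rs_scale d v) = rs_scale (c * d) v.
Proof. by rewrite /rs_scale scalerA mulr_algl scalerA. Qed.
Fact rs_scale1 : left_id 1 rs_scale.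
Proof. by move=> v; rewrite /rs_scale scale1r scale1r. Qed.
Fact rs_scaleDr : right_distributive rs_scale +%R.
Proof. by move=> c u v; rewrite /rs_scale -scalerDr. Qed.
Fact rs_scaleDl v : {morph rs_scale^~ v : c d / c + d}.
Proof. by move=> c d; rewrite /rs_scale !scalerDl. Qed.

HB.instance Definition _ := GRing.Zmodule_isLmodule.Build k V
  rs_scaleA rs_scale1 rs_scaleDr rs_scaleDl.

End RestrictScalars.

Definition finite_dimensional (k : fieldType) (R : algType k) (M : lmodType R)
  : Prop :=
  exists n, inhabited (@Vector.axiom k n (restrict_scalars M)).

(* The module on a k-vector space V on which x and y act by given
   endomorphisms X and Y subject to the defining relation. *)
Definition repr_module (k : fieldType) (V : lmodType k) (X Y : {linear V -> V})
  (XY : forall v, X (Y v) - Y (X v) = Y (Y v)) : Type := V.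

Lemma act_jordan_rel (A : nzRingType) (V : zmodType) (act : A -> V -> V)
    (actD : forall p q v, act (p + q) v = act p v + act q v)
    (actN : forall p v, act (- p) v = - act p v)
    (actM : forall p q v, act (p * q) v = act p (act q v)) (x y : A) v :
  act (jordan_rel x y) v
    = act x (act y v) - act y (act x v) - act y (act y v).
Proof. by rewrite /jordan_rel expr2 !(actD, actN, actM). Qed.

Section ReprModule.
Variables (k : fieldType) (V : lmodType k) (X Y : {linear V -> V}).
Hypothesis XY : forall v, X (Y v) - Y (X v) = Y (Y v).
Local Notation A := (free_algebra k).
Local Notation M := (repr_module XY).

Definition word_act (w : seq bool) (v : V) : V :=
  foldr (fun b : bool => if b then Y : V -> V else X) v w.

Definition free_act (p : A) (v : V) : V :=
  \sum_(w <- msupp p) p@_w *: word_act w v.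

Lemma word_act_is_linear w c u v :
  word_act w (c *: u + v) = c *: word_act w u + word_act w v.
Proof. by elim: w => [|[] w IHw] //=; rewrite IHw linearP. Qed.

Lemma free_actEw (D : {fset {fmonom bool}}) (p : A) v :
  (msupp p `<=` D)%fset -> free_act p v = \sum_(w <- D) p@_w *: word_act w v.
Proof.
move=> sD; rewrite [LHS](big_fset_incl _ sD) // => w _ /mcoeff_outdom ->.
by rewrite scale0r.
Qed.

Lemma free_actU c w v : free_act << c *g w >> v = c *: word_act w v.
Proof. by rewrite (free_actEw _ msuppU_le) big_seq_fset1 mcoeffUU. Qed.

Lemma free_actDl p q v : free_act (p + q) v = free_act p v + free_act q v.
Proof.
rewrite (free_actEw v (msuppD_le p q)) (free_actEw v (fsubsetUl _ (msupp q))).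
rewrite (free_actEw v (fsubsetUr (msupp p) _)) -big_split /=.
by apply: eq_bigr => w _; rewrite mcoeffD scalerDl.
Qed.

Lemma free_act_is_linear p c u v :
  free_act p (c *: u + v) = c *: free_act p u + free_act p v.
Proof.
rewrite /free_act scaler_sumr -big_split /=; apply: eq_bigr => w _.
by rewrite word_act_is_linear scalerDr !scalerA mulrC.
Qed.

Lemma free_act0l v : free_act 0 v = 0.
Proof. by rewrite /free_act msupp0 big_seq_fset0. Qed.

Lemma free_act_suml (I : Type) (s : seq I) (F : I -> A) v :
  free_act (\sum_(i <- s) F i) v = \sum_(i <- s) free_act (F i) v.
Proof.
exact: (big_morph (free_act^~ v) (fun p q => free_actDl p q v) (free_act0l v)).
Qed.

Lemma free_actM (p q : A) v : free_act (p * q) v = free_act p (free_act q v).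
Proof.
rewrite malgME free_act_suml; apply: eq_bigr => u _; rewrite free_act_suml.
have D : {morph word_act u : a b / a + b}.
  by move=> a b; rewrite -[a in LHS]scale1r word_act_is_linear scale1r.
have Z : word_act u 0 = 0 by apply: (addIr (word_act u 0)); rewrite -D !add0r.
rewrite [X in _ *: X](big_morph _ D Z) scaler_sumr; apply: eq_bigr => w _.
rewrite free_actU -[_ *: word_act w v]addr0 word_act_is_linear Z addr0 scalerA.
by rewrite fmM /word_act foldr_cat.
Qed.

Lemma free_act_x v : free_act (free_x k) v = X v.
Proof. by rewrite /free_x free_actU scale1r fmU. Qed.

Lemma free_act_y v : free_act (free_y k) v = Y v.
Proof. by rewrite /free_y free_actU scale1r fmU. Qed.

Lemma free_act1 v : free_act 1 v = v.
Proof. by rewrite [1]/(<< _ >>) free_actU scale1r fm1. Qed.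

Lemma free_act0r p : free_act p 0 = 0.
Proof.
apply: (addIr (free_act p 0)).
by rewrite -{1}[free_act p 0]scale1r -free_act_is_linear scale1r !add0r.
Qed.

Lemma free_actNl p v : free_act (- p) v = - free_act p v.
Proof.
by apply: (addrI (free_act p v)); rewrite -free_actDl !subrr free_act0l.
Qed.

Lemma free_act_rel v : free_act (jordan_rel (free_x k) (free_y k)) v = 0.
Proof.
rewrite (act_jordan_rel free_actDl free_actNl free_actM).
by rewrite !free_act_x !free_act_y XY subrr.
Qed.

Lemma free_act_ideal p v :
  p \in two_sided_ideal A (jordan_rel (free_x k) (free_y k)) ->
  free_act p v = 0.
Proof.
move=> /two_sided_idealP [s ->]; rewrite free_act_suml big1 // => t _.
by rewrite !free_actM free_act_rel free_act0r.
Qed.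

HB.instance Definition _ := GRing.Zmodule.on M.

Definition jordan_act (r : jordan_plane k) (v : M) : M :=
  free_act (quo_repr r) v.

Lemma jordan_actE p v : jordan_act (quo _ p) v = free_act p v.
Proof.
apply/eqP; rewrite -subr_eq0 -free_actNl -free_actDl -oppr_eq0 -free_actNl.
by rewrite opprB; apply/eqP; apply: free_act_ideal; apply: quo_reprB.
Qed.

Fact jordan_actA r s v : jordan_act r (jordan_act s v) = jordan_act (r * s) v.
Proof.
rewrite -[r]quo_reprK -[s]quo_reprK -quoM !jordan_actE.
by rewrite free_actM.
Qed.

Fact jordan_act1 : left_id 1 jordan_act.
Proof. by move=> v; rewrite [LHS]jordan_actE free_act1. Qed.

Fact jordan_actDr : right_distributive jordan_act +%R.
Proof.
move=> r u v; rewrite /jordan_act -{1}[u]scale1r free_act_is_linear.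
by rewrite scale1r.
Qed.

Fact jordan_actDl v : {morph jordan_act^~ v : r s / r + s}.
Proof.
move=> r s; rewrite -[r]quo_reprK -[s]quo_reprK -quoD !jordan_actE.
exact: free_actDl.
Qed.

HB.instance Definition _ := GRing.Zmodule_isLmodule.Build (jordan_plane k) M
  jordan_actA jordan_act1 jordan_actDr jordan_actDl.

Lemma repr_module_x (v : M) : jordan_x k *: v = X v.
Proof. by rewrite [LHS]jordan_actE free_act_x. Qed.

Lemma repr_module_y (v : M) : jordan_y k *: v = Y v.
Proof. by rewrite [LHS]jordan_actE free_act_y. Qed.

Lemma repr_module_scale (c : k) (v : M) :
  (c%:A : jordan_plane k) *: v = c *: (v : V).
Proof.
have -> : c%:A = quo (jordan_proper k) << c *g mone >>.
  rewrite -[1]/(quo (jordan_proper k) 1) -quoZ; congr quo.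
  by rewrite -[LHS]mul_malgC mulr1.
by rewrite [LHS]jordan_actE free_actU fm1.
Qed.

End ReprModule.

(* The underlying space k u is k itself, with u = 1. *)
Section OneDimModule.
Variables (k : fieldType) (a : k).

Definition scal_end : {linear k^o -> k^o} := *:%R a.
Definition zero_end : {linear k^o -> k^o} := \0.

Fact S_relation (v : k^o) :
  scal_end (zero_end v) - zero_end (scal_end v) = zero_end (zero_end v).
Proof. by rewrite /= scaler0 subrr. Qed.

Definition S_module : lmodType (jordan_plane k) := repr_module S_relation.

Lemma S_module_x (u : S_module) : jordan_x k *: u = a%:A *: u.
Proof. by rewrite repr_module_scale repr_module_x. Qed.

Lemma S_module_y (u : S_module) : jordan_y k *: u = 0.
Proof. exact: repr_module_y. Qed.

End OneDimModule.

(* The module of column vectors on which x and y act by the matrices X and Y. *)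
Section MatrixModule.
Variables (k : fieldType) (n : nat) (X Y : 'M[k]_n).
Hypothesis XY : X *m Y - Y *m X = Y *m Y.

Fact mx_module_relation (v : 'cV[k]_n) :
  mulmx X (mulmx Y v) - mulmx Y (mulmx X v) = mulmx Y (mulmx Y v).
Proof. by rewrite !mulmxA -mulmxBl XY. Qed.

Definition mx_module : lmodType (jordan_plane k) :=
  repr_module mx_module_relation.

Lemma mx_module_x (v : mx_module) : jordan_x k *: v = X *m v.
Proof. exact: repr_module_x. Qed.

Lemma mx_module_y (v : mx_module) : jordan_y k *: v = Y *m v.
Proof. exact: repr_module_y. Qed.

End MatrixModule.

Lemma diag_relation (k : fieldType) n (a : 'rV[k]_n) :
  diag_mx a *m (0 : 'M_n) - (0 : 'M_n) *m diag_mx a = (0 : 'M_n) *m (0 : 'M_n).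
Proof. by rewrite mulmx0 !mul0mx subrr. Qed.

(* Main.v *)
From HB Require Import structures.
Require Import Defs.
From mathcomp Require Import all_boot all_order all_algebra.
From mathcomp Require Import finmap monalg boolp.
From mathcomp Require Import ring.
Import GRing.Theory.
Local Open Scope ring_scope.

Set Implicit Arguments.
Unset Strict Implicit.
Unset Printing Implicit Defensive.

(** The crux is that y acts nilpotently on every finite dimensional module M
    ([jordan_y_nilpotent]).  The relation xy - yx = y^2 says that the commutator
    with x is the derivation y^2 d/dy on polynomials in y
    ([jordan_commutator]), so the ideal of polynomials p with p(y) M = 0 is
    stable under p |-> X^2 p'.  It is nonzero by Cayley-Hamilton.  If it
    contains X^e q with q(0) <> 0 and t = deg q, then it also contains
    X^2 (X^e q)' - (e + t) X (X^e q) = X^(e+1) (X q' - t q), and X q' - t q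
    has degree below t and, in characteristic 0, a nonzero constant term as
    long as t > 0.  Descending on t shows that a power of X kills M.

    Hence an irreducible submodule N meets ker y.  This kernel is stable under
    x, because y x = (x - y) y, and x is annihilated by a product of linear
    factors over an algebraically closed field, so some nonzero u in N
    satisfies y u = 0 and x u = a u.  The line k u is a submodule, and by
    minimality N = k u ([irreducible_submodule_line]).  This identifies the
    irreducible modules with the S_a; the scalar by which x acts separates them.
    A finite direct sum of such lines is a module with Y = 0 and X diagonal, and
    conversely the coordinate lines of a diagonal module decompose it
    ([diagonal_completely_reducible]).

    All of this is carried out in an arbitrary algebra generated by two elements
    subject to the relation; the quotient of the free algebra only enters
    through [jordan_generated] and [isomorphic_repr_module]. *)

(** * Modules over an algebra *)

Lemma inj_surj_bijective (A B : Type) (f : A -> B) :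
  injective f -> (forall b, exists a, f a = b) -> bijective f.
Proof.
by move=> f_inj /choice[g fK]; exists g => // a; apply: f_inj; rewrite fK.
Qed.

Lemma submod_closedZ (R : nzRingType) (M : lmodType R) (N : {pred M}) r m :
  submod_closed N -> m \in N -> r *: m \in N.
Proof. by case=> N0 NP mN; rewrite -[_ *: _]addr0 NP. Qed.

Section Scalars.
Variables (k : fieldType) (R : algType k) (M : lmodType R).
Implicit Types (r : R) (c d : k) (m : M).

Lemma scalerA_alg c d m : c%:A *: (d%:A *: m) = (c * d)%:A *: m.
Proof. by rewrite scalerA mulr_algl scalerA. Qed.

Lemma scalerC_alg r c m : r *: (c%:A *: m) = c%:A *: (r *: m).
Proof. by rewrite !scalerA mulr_algl mulr_algr. Qed.

Lemma scaler_alg_eq0 c m : m != 0 -> c%:A *: m = 0 -> c = 0.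
Proof.
move=> m0 cm0; apply/eqP; apply: contraNT m0 => c0; apply/eqP.
by rewrite -[m]scale1r -[1](scale1r 1) -(mulVf c0) -scalerA_alg cm0 scaler0.
Qed.
End Scalars.

(** Isomorphisms commute with x, so the scalar by which x acts is an
    invariant. *)
Lemma isomorphic_eigenvalue (k : fieldType) (R : algType k) (x : R)
    (M N : lmodType R) (a b : k) :
  (forall m : M, x *: m = a%:A *: m) -> (forall n : N, x *: n = b%:A *: n) ->
  (exists m : M, m != 0) -> isomorphic M N -> a = b.
Proof.
move=> xM xN [m m0] [f fbij].
have fm0 : f m != 0 by rewrite -(raddf0 f) (inj_eq (bij_inj fbij)).
apply/eqP; rewrite -subr_eq0; apply/eqP; apply: (scaler_alg_eq0 fm0).
by rewrite !scalerBl -xN -!linearZ xM /= subrr.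
Qed.

(** When a product of operators kills a nonzero vector, some partial product is
    the last one not to kill it.  Applied to powers of y this yields a kernel
    vector, and applied to the linear factors of a polynomial an eigenvector;
    tracking the property [P] keeps that vector inside a given submodule. *)
Lemma last_nonzero (R : nzRingType) (M : lmodType R) (P : M -> Prop)
    (s : seq R) (m : M) :
  (forall r v, r \in s -> P v -> P (r *: v)) -> P m -> m != 0 ->
  (\prod_(r <- s) r) *: m = 0 ->
  exists r v, [/\ r \in s, P v, v != 0 & r *: v = 0].
Proof.
elim/last_ind: s m => [|s r IHs] m Ps Pm m0.
  by rewrite big_nil scale1r => mE; rewrite mE eqxx in m0.
have rs : r \in rcons s r by rewrite mem_rcons mem_head.
have sub t : t \in s -> t \in rcons s r.
  by rewrite mem_rcons inE => ->; rewrite orbT.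
rewrite big_rcons /= -scalerA; have [rm0 _|rm0 prod0] := eqVneq (r *: m) 0.
  by exists r, m.
have [||t [v [ts Pv v0 tv]]] := IHs (r *: m) _ _ rm0 prod0.
- by move=> t v ts; apply/Ps/sub.
- exact: Ps.
by exists t, v; split=> //; apply: sub.
Qed.

(** In coordinates [r] acts by a matrix, and its characteristic polynomial
    annihilates M by Cayley-Hamilton. *)
Lemma scale_fd_annihilated (k : fieldType) (R : algType k) (M : lmodType R)
    (r : R) :
  finite_dimensional M ->
  exists2 p : {poly k}, p != 0 & forall m : M, horner_alg r p *: m = 0.
Proof.
case=> n [] [f f_lin [g fK gK]].
case: n f f_lin g fK gK => [|n] f f_lin g fK gK.
  (* Matrices of size 0 do not form a nontrivial ring; M = 0 is killed by 1. *)
  exists 1; first exact: oner_neq0.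
  move=> m; rewrite rmorph1 scale1r; apply: (can_inj fK).
  by rewrite [LHS]thinmx0 [RHS]thinmx0.
have fD (u v : M) : f (u + v) = f u + f v.
  by have := f_lin 1 u v; rewrite !scale1r.
have f0 : f (0 : M) = 0 by apply: (addIr (f (0 : M))); rewrite -fD !add0r.
have fZ c (v : M) : f (c%:A *: v) = c *: f v.
  by have := f_lin c v 0; rewrite !addr0 [f 0]f0 addr0.
pose phi (v : 'rV_n.+1) := f (r *: (g v : M)).
have phi_lin : linear phi.
  move=> c u v; rewrite /phi.
  have -> : (g (c *: u + v) : M) = c%:A *: (g u : M) + (g v : M).
    by apply: (can_inj fK); rewrite gK fD fZ !gK.
  by rewrite -fZ -fD scalerDr !scalerA mulr_algl mulr_algr.
pose phiL : {linear 'rV_n.+1 -> 'rV_n.+1} :=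
  HB.pack phi (GRing.isLinear.Build _ _ _ _ phi phi_lin).
pose A := lin1_mx phi.
have fE (m : M) : f (r *: m) = f m *m A.
  by rewrite (mul_rV_lin1 phiL) /= /phi fK.
have pE p (m : M) : f (horner_alg r p *: m) = f m *m horner_mx A p.
  elim/poly_ind: p m => [|p c IHp] m.
    rewrite (raddf0 (horner_alg r)) scale0r (raddf0 (horner_mx A)).
    by rewrite mulmx0.
  (* On the left, r must act last for the induction hypothesis to apply. *)
  rewrite [in LHS](mulrC p) !rmorphD !rmorphM /=.
  rewrite horner_algX horner_algC horner_mx_X horner_mx_C.
  rewrite scalerDl fD fZ mulmxDr mul_mx_scalar -scalerA fE IHp.
  by rewrite -mulmxE mulmxA.
exists (char_poly A); first by rewrite monic_neq0 // char_poly_monic.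
move=> m; apply: (can_inj fK); rewrite pE Cayley_Hamilton mulmx0.
by rewrite f0.
Qed.

(** * Algebras generated by two elements *)

(** Generation is encoded as an induction principle, which is the form in which
    it is applied: to the commutation of a map with the action, to the
    stability of a line, and to the diagonality of the action. *)
Definition generated_by (k : fieldType) (R : algType k) (x y : R) : Prop :=
  forall P : R -> Prop,
    (forall c : k, P c%:A) ->
    (forall r s, P r -> P s -> P (r + s)) ->
    (forall r s, P r -> P s -> P (r * s)) ->
    P x -> P y -> forall r, P r.

Section Generated.
Variables (k : fieldType) (R : algType k) (x y : R).
Hypothesis gen : generated_by x y.

(** The elements of R commuting with [f] form a subalgebra, so it suffices to
    test [f] on scalars and on the two generators. *)
Lemma generated_isomorphic (M N : lmodType R) (f : N -> M) :
  bijective f -> {morph f : u v / u + v} ->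
  (forall (c : k) v, f (c%:A *: v) = c%:A *: f v) ->
  (forall v, f (x *: v) = x *: f v) -> (forall v, f (y *: v) = y *: f v) ->
  isomorphic M N.
Proof.
case=> g fK gK fD fZ fx fy.
have f_scale r v : f (r *: v) = r *: f v.
  move: r v; apply: gen => // r s IHr IHs v.
    by rewrite !scalerDl fD IHr IHs.
  by rewrite -!scalerA IHr IHs.
have f_lin : linear f by move=> r u v; rewrite fD f_scale.
pose F : {linear N -> M} := HB.pack f (GRing.isLinear.Build _ _ _ _ f f_lin).
pose G : {linear M -> N} :=
  HB.pack g (GRing.isLinear.Build _ _ _ _ g (can2_linear (f := F) fK gK)).
by exists G; exists f.
Qed.

(** The line spanned by a common eigenvector of the generators is a
    submodule. *)
Lemma eigenvector_scale (M : lmodType R) (u : M) (a : k) :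
  x *: u = a%:A *: u -> y *: u = 0 ->
  forall r, exists c : k, r *: u = c%:A *: u.
Proof.
move=> xu yu; apply: gen => [c|r s [c rE] [d sE]|r s [c rE] [d sE]||].
- by exists c.
- by exists (c + d); rewrite !scalerDl rE sE.
- by exists (d * c); rewrite -[LHS]scalerA sE scalerC_alg rE scalerA_alg.
- by exists a.
- by exists 0; rewrite !scale0r.
Qed.

(** The whole algebra acts diagonally in the coordinates [f], because the
    generators do.  The coordinate axes are therefore submodules; being lines
    they are irreducible, and M is their direct sum. *)
Lemma diagonal_completely_reducible n (a : 'rV[k]_n) (M : lmodType R)
    (f : M -> 'cV[k]_n) :
  bijective f -> {morph f : u v / u + v} ->
  (forall (c : k) m, f (c%:A *: m) = c *: f m) ->
  (forall m, f (x *: m) = diag_mx a *m f m) -> (forall m, f (y *: m) = 0) ->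
  finite_dimensional M /\ completely_reducible M.
Proof.
case=> g fK gK fD fZ fx fy; split.
  exists n; constructor; exists (fun m : M => (f m)^T).
    by move=> c u v; rewrite fD [f (c *: u)]fZ linearP.
  exists (fun v => g v^T); first by move=> m; rewrite trmxK fK.
  by move=> v; rewrite gK trmxK.
have f0 : f 0 = 0 by apply: (addIr (f 0)); rewrite -fD !add0r.
have f_scale r i : exists c, forall m, f (r *: m) i 0 = c * f m i 0.
  move: r; apply: gen => [c|r s [c rE] [d sE]|r s [c rE] [d sE]||].
  - by exists c => m; rewrite fZ mxE.
  - by exists (c + d) => m; rewrite scalerDl fD mxE rE sE mulrDl.
  - by exists (c * d) => m; rewrite -scalerA rE sE mulrA.
  - by exists (a 0 i) => m; rewrite fx mul_diag_mx mxE.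
  - by exists 0 => m; rewrite fy mxE mul0r.
pose N i : {pred M} := [pred m | [forall j, (j != i) ==> (f m j 0 == 0)]].
have NP i m : reflect (forall j, j != i -> f m j 0 = 0) (m \in N i).
  apply: (iffP forallP) => Nm j; first by move/(implyP (Nm j))/eqP.
  by apply/implyP => ji; apply/eqP/Nm.
have Nsub i : submod_closed (N i).
  split; first by apply/NP => j _; rewrite f0 mxE.
  move=> r u v /NP Nu /NP Nv; apply/NP => j ji.
  have [c rE] := f_scale r j.
  by rewrite fD mxE rE Nu // Nv // mulr0 addr0.
have NE i u v : u \in N i -> v \in N i -> f u i 0 = f v i 0 -> u = v.
  move=> /NP Nu /NP Nv uv; apply: (can_inj fK); apply/matrixP => j j'.
  by rewrite ord1; have [->//|ji] := eqVneq j i; rewrite Nu ?Nv.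
pose d i (c : k) : M := g (c *: delta_mx i 0).
have fd i c j : f (d i c) j 0 = c *+ (j == i).
  by rewrite gK !mxE eqxx andbT mulr_natr.
have dN i c : d i c \in N i.
  by apply/NP => j /negPf ji; rewrite fd ji.
exists n, N; split=> [i|].
  split=> //.
    exists (d i 1) => //; apply/eqP => d0.
    have := fd i 1 i; rewrite d0 f0 mxE eqxx; apply/eqP.
    by rewrite eq_sym oner_neq0.
  move=> L Lsub LN [m mL m0] u uN.
  have fm0 : f m i 0 != 0.
    apply: contraNneq m0 => fm0; apply/eqP; apply: (NE i).
    - exact: LN.
    - by case: (Nsub i).
    - by rewrite fm0 f0 mxE.
  suff -> : u = (f u i 0 / f m i 0)%:A *: m by apply: submod_closedZ.
  apply: (NE i) => //; first by apply: submod_closedZ => //; apply: LN.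
  by rewrite fZ mxE divfK.
split=> // m.
have f_sum (c : {ffun 'I_n -> M}) : f (\sum_i c i) = \sum_i f (c i).
  exact: (big_morph f fD f0).
exists [ffun i => d i (f m i 0)]; split.
  split=> [i|]; first by rewrite ffunE.
  apply: (can_inj fK); rewrite f_sum; apply/matrixP => i j; rewrite ord1 summxE.
  rewrite (bigD1 i) //= ffunE fd eqxx big1 ?addr0 // => j' /negPf ji.
  by rewrite ffunE fd eq_sym ji.
move=> c [cN mE]; apply/ffunP => i; rewrite ffunE; apply: (NE i) => //.
rewrite fd eqxx mE f_sum summxE (bigD1 i) //= big1 ?addr0 // => j ji.
by have /NP -> := cN j; rewrite // eq_sym.
Qed.
End Generated.

(** * Nilpotency of y *)

Section Commutator.
Variables (k : fieldType) (R : algType k) (x y : R).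
Hypothesis xy : jordan_rel x y = 0.

(** Both sides are derivations in [p] agreeing at the variable, where they give
    the defining relation; the induction follows Horner's scheme. *)
Lemma jordan_commutator (p : {poly k}) :
  x * horner_alg y p - horner_alg y p * x = horner_alg y (p^`() * 'X^2).
Proof.
have xyE : x * y = y * x + y ^+ 2.
  by apply/eqP; rewrite addrC -subr_eq -subr_eq0; apply/eqP.
elim/poly_ind: p => [|p c IHp].
  by rewrite deriv0 mul0r (raddf0 (horner_alg y)) mulr0 mul0r subrr.
have pY : horner_alg y p * y = y * horner_alg y p.
  by have := congr1 (horner_alg y) (mulrC p 'X); rewrite !rmorphM /= horner_algX.
have -> : (p * 'X + c%:P)^`() * 'X^2 = p * 'X * 'X + p^`() * 'X^2 * 'X.
  by rewrite derivMXaddC mulrDl expr2 !mulrA.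
rewrite !rmorphD !(rmorphM (horner_alg y) _ 'X) /= horner_algX horner_algC -IHp.
rewrite mulrDr mulrDl mulr_algl mulr_algr opprD addrACA subrr addr0.
rewrite mulrBl -!mulrA xyE mulrDr pY.
by rewrite -expr2 [RHS]addrC opprD addrA subrK.
Qed.

(** The polynomials in y that kill M form a nonzero ideal [ann].  The descent
    lowers the degree of the factor [q] prime to the variable in an element
    q X^e of this ideal until only a power of the variable is left. *)
Lemma jordan_y_nilpotent (M : lmodType R) :
  [pchar k] =i pred0 -> finite_dimensional M ->
  exists e, forall m : M, y ^+ e *: m = 0.
Proof.
move=> /pcharf0P char0 fdM.
pose ann p := forall m : M, horner_alg y p *: m = 0.
have annM p (q : {poly k}) : ann p -> ann (q * p).
  by move=> ap m; rewrite rmorphM /= -scalerA ap scaler0.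
have annB p q : ann p -> ann q -> ann (p - q).
  by move=> ap aq m; rewrite rmorphB /= scalerBl ap aq subrr.
have annD p : ann p -> ann (p^`() * 'X^2).
  move=> ap m; rewrite -jordan_commutator scalerBl -!scalerA !ap scaler0.
  by rewrite subrr.
have descent n e (q : {poly k}) : (size q <= n)%N -> q`_0 != 0 ->
    ann (q * 'X^e) -> exists e', ann 'X^e'.
  elim: n e q => [|n IHn] e q szq q0 annq.
    by move: q0; rewrite nth_default ?eqxx // (leq_trans szq).
  have [szq1|szq1] := leqP (size q) 1.
    exists e; have := annM _ (q`_0)^-1%:P annq.
    by rewrite mulrA [X in _ * X * _]size1_polyC // -polyCM mulVf // mul1r.
  (* X q' - t q multiplies the coefficient of X^i by i - t: this kills the
     leading term, and in characteristic 0 it kills nothing else. *)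
  pose t := (size q).-1; pose q2 : {poly k} := q^`() * 'X - q *+ t.
  have q2E i : q2`_i = (i%:R - t%:R) * q`_i.
    rewrite coefB coefMn coefMX mulrBl !mulr_natl; congr (_ - _).
    by case: i => [|i] //=; rewrite coef_deriv.
  apply: (IHn e.+1 q2).
  - rewrite -ltnS; apply: leq_trans szq.
    rewrite -[size q](ltn_predK szq1) ltnS.
    apply/leq_sizeP => i; rewrite leq_eqVlt q2E => /predU1P[<-|lti].
      by rewrite subrr mul0r.
    by rewrite nth_default ?mulr0 // -(ltn_predK szq1).
  - rewrite q2E mulf_neq0 // sub0r oppr_eq0 char0.
    by rewrite -lt0n -ltnS (ltn_predK szq1).
  have -> : q2 * 'X^(e.+1) =
      (q * 'X^e)^`() * 'X^2 - (e + t)%:R * 'X * (q * 'X^e).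
    have eX : 'X^(e.-1) *+ e * 'X^2 = e%:R * ('X^e * 'X) :> {poly k}.
      case: (e) => [|i] /=; rewrite ?mul0r // mulrnAl mulr_natl.
      by rewrite expr2 exprSr !mulrA.
    rewrite derivM derivXn [in RHS]mulrDl -[q * _ * 'X^2]mulrA eX exprSr /q2.
    by ring.
  by apply: annB; [apply: annD | apply: annM].
have [p p0 annp] := scale_fd_annihilated y fdM.
have [e [q]] := multiplicity_XsubC p 0.
rewrite p0 /= rootE horner_coef0 subr0 => q0 pE.
have [||e' annXe] := descent (size q) e q _ q0 => //; first by rewrite -pE.
by exists e' => m; have := annXe m; rewrite rmorphXn /= horner_algX.
Qed.
End Commutator.

(** * Irreducible and completely reducible modules *)

Section Irreducible.
Variables (k : closedFieldType) (R : algType k) (x y : R).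
Hypotheses (char0 : [pchar k] =i pred0) (xy : jordan_rel x y = 0).
Hypothesis gen : generated_by x y.

(** Nilpotency of y gives a vector of N killed by y, a split polynomial
    annihilating x turns it into an eigenvector of x, and minimality of N
    applies to the line it spans. *)
Lemma irreducible_submodule_line (M : lmodType R) (N : {pred M}) :
  finite_dimensional M -> irreducible_submodule N ->
  exists (u : M) (a : k),
    [/\ u \in N, u != 0, x *: u = a%:A *: u, y *: u = 0
      & forall m, m \in N -> exists c : k, m = c%:A *: u].
Proof.
move=> fdM [Nsub [m mN m0] Nmin].
have [e ye] := jordan_y_nilpotent xy char0 fdM.
have [||_ [v [/nseqP[-> _] vN v0 yv]]] :=
  @last_nonzero _ M (fun v => v \in N) (nseq e y) m _ mN m0.
- by move=> r v _; apply: submod_closedZ.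
- by rewrite big_nseq -Monoid.iteropE; apply: ye.
have [p p0 px] := scale_fd_annihilated x fdM.
have [s pE] := closed_field_poly_normal p.
pose P w := w \in N /\ y *: w = 0.
have [||r [u [rs [uN yu] u0 ru]]] := @last_nonzero _ M P
  [seq x - a%:A | a <- s] v _ (conj vN yv) v0.
- move=> r w /mapP[a _ ->] [wN yw]; split; first exact: submod_closedZ.
  (* The kernel of y is stable under x. *)
  have yx : y * x = (x - y) * y.
    move/eqP: xy; rewrite /jordan_rel addrAC subr_eq0 => /eqP yxE.
    by rewrite mulrBl -expr2 yxE.
  rewrite scalerBl scalerBr scalerA yx -scalerA yw scaler0.
  by rewrite scalerC_alg yw scaler0 subrr.
- rewrite big_map; have := px v.
  rewrite pE linearZ /= rmorph_prod /= -scalerA.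
  have -> : \prod_(a <- s) horner_alg x ('X - a%:P) = \prod_(a <- s) (x - a%:A).
    by apply: eq_bigr => a _; rewrite rmorphB /= horner_algX horner_algC.
  move=> pv; apply/eqP; apply: contraNT p0 => prod0.
  by rewrite -lead_coef_eq0 (scaler_alg_eq0 prod0 pv).
have /mapP[a _ rE] := rs.
have xu : x *: u = a%:A *: u.
  by apply/eqP; rewrite -subr_eq0 -scalerBl -rE ru.
exists u, a; split=> // w wN.
pose L : {pred M} := fun w => `[< exists c : k, w = c%:A *: u >].
suff /asboolP : w \in L by [].
apply: (Nmin L) wN.
- split; first by apply/asboolP; exists 0; rewrite !scale0r.
  move=> t _ _ /asboolP[c ->] /asboolP[d ->]; apply/asboolP.
  have [b tu] := eigenvector_scale gen xu yu t.
  by exists (c * b + d); rewrite scalerC_alg tu scalerA_alg !scalerDl.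
- by move=> _ /asboolP[c ->]; apply: submod_closedZ.
- by exists u => //; apply/asboolP; exists 1; rewrite !scale1r.
Qed.

(** M is the line k u found above, and c |-> c u carries the action on S_a to
    the action on M. *)
Lemma irreducible_coordinate (M : lmodType R) :
  finite_dimensional M -> irreducible M ->
  exists (a : k) (f : k^o -> M),
    [/\ bijective f, {morph f : u v / u + v},
        forall c v, f (c *: v) = c%:A *: f v,
        forall v, f (a *: v) = x *: f v
      & forall v, y *: f v = 0].
Proof.
move=> fdM Mirr.
have [u [a [_ u0 xu yu line]]] := irreducible_submodule_line fdM Mirr.
exists a, (fun c => c%:A *: u); split.
- apply: inj_surj_bijective => [c d /eqP|m].
    rewrite -subr_eq0 -!scalerBl => /eqP.
    by move/(scaler_alg_eq0 u0)/eqP; rewrite subr_eq0 => /eqP.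
  by have [c ->] := line m isT; exists c.
- by move=> c d; rewrite !scalerDl.
- by move=> c d; rewrite scalerA_alg.
- by move=> c; rewrite scalerC_alg xu scalerA_alg mulrC.
- by move=> c; rewrite scalerC_alg yu scaler0.
Qed.

(** One generator for each irreducible summand gives a basis of M. *)
Lemma completely_reducible_coordinates (M : lmodType R) :
  finite_dimensional M -> completely_reducible M ->
  exists n (a : 'rV[k]_n) (f : 'cV[k]_n -> M),
    [/\ bijective f, {morph f : u v / u + v},
        forall c v, f (c *: v) = c%:A *: f v,
        forall v, f (diag_mx a *m v) = x *: f v
      & forall v, y *: f v = 0].
Proof.
move=> fdM [n [N [Nirr [Nsub Ndec]]]].
have [u /fin_all_exists[a uP]] := fin_all_exists (fun i =>
  irreducible_submodule_line fdM (Nirr i)).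
pose f (v : 'cV[k]_n) : M := \sum_i (v i 0)%:A *: u i.
exists n, (\row_i a i), f.
have uN i c : c%:A *: u i \in N i.
  by case: (uP i) => ? _ _ _ _; apply: submod_closedZ.
have f_surj m : exists v, f v = m.
  have [c [[cN mE] _]] := Ndec m.
  have [d dE] : exists d : 'I_n -> k, forall i, c i = (d i)%:A *: u i.
    apply: (@fin_all_exists _ (fun=> k) (fun i d => c i = d%:A *: u i)) => i.
    by have [_ _ _ _ line] := uP i; apply: line.
  exists (\col_i d i); rewrite mE; apply: eq_bigr => i _.
  by rewrite mxE dE.
have f_inj : injective f.
  (* Equal images have the same components in the direct sum. *)
  move=> v w vw; have [c [_ c_uniq]] := Ndec (f v).
  pose cf (z : 'cV[k]_n) := [ffun i => (z i 0)%:A *: u i].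
  have cfP z : f z = f v -> c = cf z.
    move=> zv; apply: c_uniq; split=> [i|]; first by rewrite ffunE.
    by rewrite -zv; apply: eq_bigr => i _; rewrite ffunE.
  apply/matrixP => i j; rewrite ord1; apply/eqP; rewrite -subr_eq0; apply/eqP.
  case: (uP i) => _ u0 _ _ _; apply: (scaler_alg_eq0 u0).
  have /ffunP/(_ i) : cf v = cf w by rewrite -!cfP.
  by rewrite !ffunE !scalerBl => ->; rewrite subrr.
split.
- exact: inj_surj_bijective.
- move=> v w; rewrite -big_split; apply: eq_bigr => i _.
  by rewrite /= mxE !scalerDl.
- move=> c v; rewrite scaler_sumr; apply: eq_bigr => i _.
  by rewrite mxE scalerA_alg.
- move=> v; rewrite scaler_sumr; apply: eq_bigr => i _.
  case: (uP i) => _ _ xu _ _.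
  by rewrite mul_diag_mx !mxE scalerC_alg xu scalerA_alg mulrC.
- move=> v; rewrite scaler_sumr big1 // => i _.
  by case: (uP i) => _ _ _ yu _; rewrite scalerC_alg yu scaler0.
Qed.
End Irreducible.

(** * The Jordan plane *)

(** Every element is a linear combination of words, and every word a product of
    letters. *)
Lemma free_algebra_ind (k : fieldType) (P : free_algebra k -> Prop)
    (Pscal : forall c : k, P c%:A)
    (PD : forall p q, P p -> P q -> P (p + q))
    (PM : forall p q, P p -> P q -> P (p * q))
    (Px : P (free_x k)) (Py : P (free_y k)) (p : free_algebra k) : P p.
Proof.
have Pword w : P << FMonom w >>.
  elim: w => [|b w IHw].
    by have := Pscal 1; rewrite scale1r -[FMonom [::]]fmoneE.
  suff -> : << FMonom (b :: w) >> = << fmu b >> * << FMonom w >>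
      :> free_algebra k.
    by apply: PM IHw; case: b.
  rewrite malgM_def fgmulUU mulr1; congr << _ >>.
  by apply/val_inj; rewrite /= fmM fmU.
rewrite (monalgE p); elim/big_rec: _ => [|[w] q _ Pq].
  by have := Pscal 0; rewrite scale0r.
apply: PD Pq; have cw := PM _ _ (Pscal p@_(FMonom w)) (Pword w).
(* The summand is the product of a scalar and a word. *)
apply: (eq_ind_r P cw); rewrite mulr_algl.
by apply/malgP => v; rewrite mcoeffZ !mcoeffU mulrnAr mulr1.
Qed.

Lemma jordan_generated (k : fieldType) :
  generated_by (jordan_x k) (jordan_y k).
Proof.
move=> P Pscal PD PM Px Py r.
rewrite -[r]quo_reprK; elim/free_algebra_ind: (quo_repr r) => //.
- by move=> c; rewrite quoZ; apply: Pscal.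
- by move=> p q Pp Pq; rewrite quoD; apply: PD.
- by move=> p q Pp Pq; rewrite quoM; apply: PM.
Qed.

(** A k-linear bijection intertwining X, Y with the actions of x, y is an
    isomorphism of modules; it serves both for the S_a and for matrix
    modules. *)
Lemma isomorphic_repr_module (k : fieldType) (V : lmodType k)
    (X Y : {linear V -> V}) (XY : forall v, X (Y v) - Y (X v) = Y (Y v))
    (M : lmodType (jordan_plane k)) (f : V -> M) :
  bijective f -> {morph f : u v / u + v} ->
  (forall c v, f (c *: v) = c%:A *: f v) ->
  (forall v, f (X v) = jordan_x k *: f v) ->
  (forall v, f (Y v) = jordan_y k *: f v) ->
  isomorphic M (repr_module XY).
Proof.
move=> fbij fD fZ fX fY.
apply: (@generated_isomorphic _ _ _ _ (@jordan_generated k) M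
  (repr_module XY) f) => //.
- by move=> c v; rewrite repr_module_scale fZ.
- by move=> v; rewrite repr_module_x fX.
- by move=> v; rewrite repr_module_y fY.
Qed.

Theorem corollary4p2 (k : closedFieldType) (k_char0 : [pchar k] =i pred0) :
  (* the S_a are finite dimensional and irreducible *)
  (forall a : k, finite_dimensional (S_module a) /\ irreducible (S_module a)) /\
  (* they are pairwise non-isomorphic *)
  (forall a b : k, a <> b -> ~ isomorphic (S_module a) (S_module b)) /\
  (* every finite dimensional irreducible module is one of them *)
  (forall M : lmodType (jordan_plane k),
     finite_dimensional M -> irreducible M ->
     exists a : k, isomorphic M (S_module a)) /\
  (* completely reducible modules are given by X = diag(a_1,..,a_n), Y = 0 *)
  (forall M : lmodType (jordan_plane k),
     finite_dimensional M /\ completely_reducible M <->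
     exists (n : nat) (a : 'rV[k]_n), 
       isomorphic M (mx_module (X := diag_mx a) (Y := 0) (diag_relation a))).
Proof.
split; [|split; [|split]].
- move=> a; split.
    exists 1%N; constructor; exists (fun v : k^o => v%:M : 'rV[k]_1).
      move=> c u v; rewrite -[c *: u]/((c%:A : jordan_plane k) *: (u : S_module a)).
      by rewrite repr_module_scale rmorphD /= scale_scalar_mx.
    exists (fun A : 'M_1 => A 0 0) => [v|A]; rewrite ?mxE //.
    by rewrite -mx11_scalar.
  split=> //; first by exists (1 : k^o) => //; exact: oner_neq0.
  (* On the underlying field, u is the multiple u / m of any nonzero m. *)
  move=> L Lsub _ [m mL m0] u _.
  have -> : u = ((u : k) / (m : k))%:A *: m.
    by rewrite repr_module_scale [RHS]divfK.
  exact: submod_closedZ.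
- move=> a b ab iso_ab; apply: ab.
  apply: (isomorphic_eigenvalue (@S_module_x k a) (@S_module_x k b)) iso_ab.
  by exists (1 : k^o); exact: oner_neq0.
- move=> M fdM Mirr.
  have [a [f [fbij fD fZ fX fY]]] := irreducible_coordinate
    k_char0 (jordan_relation k) (@jordan_generated k) fdM Mirr.
  exists a; apply: (@isomorphic_repr_module _ _ _ _ (S_relation a) M f) => // v.
  by rewrite fY -[zero_end _ v](scale0r v) fZ !scale0r.
move=> M; split=> [[fdM Mcr]|[n [a [f fbij]]]].
  have [n [a [f [fbij fD fZ fX fY]]]] := completely_reducible_coordinates
    k_char0 (jordan_relation k) (@jordan_generated k) fdM Mcr.
  exists n, a; apply: (@isomorphic_repr_module _ _ _ _
    (mx_module_relation (diag_relation a)) M f) => // v.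
  by rewrite fY /= mul0mx -(scale0r v) fZ !scale0r.
apply: (@diagonal_completely_reducible _ _ _ _ (@jordan_generated k) n a M
  f) => //.
- exact: raddfD.
- by move=> c m; rewrite linearZ /= repr_module_scale.
- by move=> m; rewrite linearZ /= mx_module_x.
- by move=> m; rewrite linearZ /= mx_module_y mul0mx.
Qed.
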